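(* Let $\sigma\in{}^{z_1}\overline{W}^{x_1}$ correspond to the pair of partitions $(\boldsymbol\lambda,\boldsymbol\mu)$, where $\boldsymbol\lambda=(\lambda_1,\lambda_2,\ldots)$ and $\boldsymbol\mu=(\mu_1,\mu_2,\ldots)$ are viewed as infinite lists with trailing zeros. Let $\lambda_1'\ge\lambda_2'\ge\lambda_3'$ be parts of $\boldsymbol\lambda$ (a three-element sublist of the infinite list $\boldsymbol\lambda$; entries equal to zero are allowed), and let $\boldsymbol\mu^{\mathrm{link}}$ be the partition obtained from $\boldsymbol\lambda$ after removing these parts. Define $$p=\sum_{j\ge1}\mu^{\mathrm{link}}_j-\sum_{j\ge1}\mu_j,\qquad \boldsymbol\lambda^{\mathrm{link}}=\operatorname{rsort}(\lambda_1'+p,\lambda_2'+p,\lambda_3'+p,\mu_1,\mu_2,\mu_3,\ldots),$$ where $\operatorname{rsort}$ means sorting in non-increasing order. Then the pair $(\boldsymbol\lambda^{\mathrm{link}},\boldsymbol\mu^{\mathrm{link}})$ corresponds to some $\sigma^{\mathrm{link}}\in{}^{z_1}\overline{W}^{x_1}$ adjacent to $\sigma$ on the graph $\mathrm{Licci}_3$, and all neighbors of $\sigma$ on $\mathrm{Licci}_3$ are obtained in this fashion for some choice of parts $\lambda_1'\ge\lambda_2'\ge\lambda_3'$.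
   Context: Let $\overline{T}$ be the infinite tree whose vertices are $u$, $x_1$, $y_1,y_2,\ldots$, $z_1,z_2,\ldots$, where $u$ is adjacent to $x_1,y_1,z_1$, and $y_j$ is adjacent to $y_{j+1}$, $z_j$ to $z_{j+1}$, for all $j\ge1$. Let $\overline{W}$ be its Weyl (Coxeter) group: generators $s_i$ ($i\in\overline{T}$), with $s_i^2=1$, $(s_is_j)^3=1$ if $i,j$ are adjacent, and $s_is_j=s_js_i$ otherwise. It acts linearly on the vector space with basis $\{\omega_i\}_{i\in\overline{T}}$ by $s_i\omega_j=\omega_j$ for $i\ne j$ and $s_i\omega_i=-\omega_i+\sum_{k\text{ adjacent to }i}\omega_k$. For a vertex $t$, $\overline{W}_t$ is the subgroup generated by all $s_i$ with $i\ne t$, and ${}^{t'}\overline{W}^{t}$ is the set of minimal length representatives of the double cosets $\overline{W}_{t'}\backslash\overline{W}/\overline{W}_t$. Pair of partitions of $\sigma$: for $\sigma\in{}^{z_1}\overline{W}^{x_1}$ write $\sigma\omega_{x_1}=\sum_i a_i\omega_i$ (then $a_i\ge0$ for $i\ne z_1$, and only finitely many $a_i$ are nonzero). Let $l_{\boldsymbol\lambda}=(x_1,u,y_1,y_2,\ldots)$, $l_{\boldsymbol\mu}=(z_2,z_3,\ldots)$, and set $\lambda_k=\sum_{j\ge k}a_{(l_{\boldsymbol\lambda})_j}$, $\mu_k=\sum_{j\ge k}a_{(l_{\boldsymbol\mu})_j}$. One says that $\sigma$ corresponds to $(\boldsymbol\lambda,\boldsymbol\mu)$. The graph $\mathrm{Licci}_3$: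 first let $\mathrm{Licci}_3^{\mathrm{bi}}$ be the bipartite graph with vertex set the disjoint union of ${}^{z_1}\overline{W}^{x_1}$ and ${}^{y_1}\overline{W}^{x_1}$, with an edge between $\sigma\in{}^{z_1}\overline{W}^{x_1}$ and $\sigma'\in{}^{y_1}\overline{W}^{x_1}$ exactly when $\overline{W}_{z_1}\sigma\overline{W}_{x_1}\cap\overline{W}_{y_1}\sigma'\overline{W}_{x_1}\neq\emptyset$. Let $\chi:{}^{z_1}\overline{W}^{x_1}\to{}^{y_1}\overline{W}^{x_1}$ be the bijection induced by the automorphism of $\overline{T}$ exchanging $y_j\leftrightarrow z_j$ for all $j$. Then $\mathrm{Licci}_3$ is the undirected graph (loops allowed) with vertex set ${}^{z_1}\overline{W}^{x_1}$ and edges $(\sigma,\chi^{-1}\sigma')$ for each edge $(\sigma,\sigma')$ of $\mathrm{Licci}_3^{\mathrm{bi}}$. *)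

(* Defs.v *)
From HB Require Import structures.
From mathcomp Require Import all_boot all_order all_algebra.
From mathcomp Require Import ring.
From mathcomp Require Import boolp classical_sets functions fsbigop.
From mathcomp Require Import freeg.

Set Implicit Arguments.
Unset Strict Implicit.
Unset Printing Implicit Defensive.

Import Order.TTheory GRing.Theory Num.Theory.

Local Open Scope classical_set_scope.
Local Open Scope quotient_scope.
Local Open Scope ring_scope.

(* Indices are 0-based: [vX] is x_1, [vY j] is y_(j+1), [vZ j] is z_(j+1).    *)
Inductive vertex := vU | vX | vY of nat | vZ of nat.

Definition vertex_enc (v : vertex) : bool + (nat + nat) :=
  match v with
  | vU => inl true
  | vX => inl false
  | vY j => inr (inl j)
  | vZ j => inr (inr j)
  end.

Definition vertex_dec (c : bool + (nat + nat)) : vertex :=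
  match c with
  | inl b => if b then vU else vX
  | inr (inl j) => vY j
  | inr (inr j) => vZ j
  end.

Lemma vertex_encK : cancel vertex_enc vertex_dec.
Proof. by case. Qed.

HB.instance Definition _ := Countable.copy vertex (can_type vertex_encK).

Definition nbrs (v : vertex) : seq vertex :=
  match v with
  | vU => [:: vX; vY 0; vZ 0]
  | vX => [:: vU]
  | vY 0 => [:: vU; vY 1]
  | vY j.+1 => [:: vY j; vY j.+2]
  | vZ 0 => [:: vU; vZ 1]
  | vZ j.+1 => [:: vZ j; vZ j.+2]
  end.

Definition adj : rel vertex := fun v w => w \in nbrs v.

Lemma vYE i j : (vY i == vY j) = (i == j).
Proof. by []. Qed.

Lemma vZE i j : (vZ i == vZ j) = (i == j).
Proof. by []. Qed.

Lemma adj_irr v : adj v v = false.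
Proof.
by case: v => [||[|j]|[|j]] //;
   rewrite /adj /= !inE ?vYE ?vZE ?(ltn_eqF (ltnSn _)) ?(gtn_eqF (ltnSn _))
           ?(ltn_eqF (leqnSn j.+2)).
Qed.

Lemma adj_sym : symmetric adj.
Proof.
by case=> [||[|i]|[|i]] [||[|j]|[|j]] //;
  rewrite /adj /= !inE ?vYE ?vZE /= ?eqSS ?orbF //;
  rewrite orbC [j == _]eq_sym [_ == i]eq_sym.
Qed.

(* The Coxeter congruence on words in the generators.  As the generators are
   involutions, the monoid with this presentation is the Coxeter group.       *)
Inductive cox : seq vertex -> seq vertex -> Prop :=
| cox_refl w : cox w w
| cox_symm w w' : cox w w' -> cox w' w
| cox_trans w1 w2 w3 : cox w1 w2 -> cox w2 w3 -> cox w1 w3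
| cox_cat v v' w w' : cox v v' -> cox w w' -> cox (v ++ w) (v' ++ w')
| cox_sq i : cox [:: i; i] [::]
| cox_braid i j : adj i j -> cox [:: i; j; i; j; i; j] [::]
| cox_comm i j : ~~ adj i j -> cox [:: i; j] [:: j; i].

Definition coxb : rel (seq vertex) := fun w w' => `[< cox w w' >].

Lemma coxb_refl : reflexive coxb.
Proof. by move=> w; apply/asboolP; exact: cox_refl. Qed.

Lemma coxb_sym : symmetric coxb.
Proof. by move=> w w'; apply/asboolP/asboolP; exact: cox_symm. Qed.

Lemma coxb_trans : transitive coxb.
Proof.
by move=> w2 w1 w3 /asboolP h /asboolP h'; apply/asboolP; exact: cox_trans h h'.
Qed.

Canonical coxb_equiv := EquivRel coxb coxb_refl coxb_sym coxb_trans.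

Definition weyl := {eq_quot coxb}.

HB.instance Definition _ := Choice.on weyl.
HB.instance Definition _ := Quotient.on weyl.
HB.instance Definition _ := EqQuotient.on weyl.

Definition wordW (w : seq vertex) : weyl := \pi_weyl w.

Lemma wordWP w w' : wordW w = wordW w' <-> cox w w'.
Proof.
split; first by move/eqP; rewrite /wordW eqmodE => /asboolP.
by move=> h; apply/eqP; rewrite /wordW eqmodE; apply/asboolP.
Qed.

Lemma reprW (sigma : weyl) : wordW (repr sigma) = sigma.
Proof. by rewrite /wordW reprK. Qed.

Lemma cox_repr w : cox (repr (wordW w)) w.
Proof. by apply/wordWP; rewrite reprW. Qed.

Definition oneW : weyl := wordW [::].
Definition mulW (sigma tau : weyl) : weyl := wordW (repr sigma ++ repr tau).
Definition invW (sigma : weyl) : weyl := wordW (rev (repr sigma)).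

Lemma mulW_word w w' : mulW (wordW w) (wordW w') = wordW (w ++ w').
Proof. by apply/wordWP; apply: cox_cat; exact: cox_repr. Qed.

Lemma cox_revl w : cox (rev w ++ w) [::].
Proof.
elim: w => [|i w IH]; first exact: cox_refl.
rewrite rev_cons cat_rcons; apply: cox_trans IH.
apply: cox_cat; first exact: cox_refl.
by rewrite -[i :: i :: w]/([:: i; i] ++ w) -[X in cox _ X]cat0s;
  apply: cox_cat; [exact: cox_sq | exact: cox_refl].
Qed.

Lemma mulWA : associative mulW.
Proof.
move=> a b c; rewrite -(reprW a) -(reprW b) -(reprW c).
by rewrite !mulW_word catA.
Qed.

Lemma mul1W : left_id oneW mulW.
Proof. by move=> a; rewrite -(reprW a) mulW_word. Qed.

Lemma mulW1 : right_id oneW mulW.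
Proof. by move=> a; rewrite -(reprW a) mulW_word cats0. Qed.

Lemma mulVW : left_inverse oneW invW mulW.
Proof.
by move=> a; rewrite -{2}(reprW a) mulW_word; apply/wordWP; exact: cox_revl.
Qed.

Lemma mulWV : right_inverse oneW invW mulW.
Proof.
move=> a; rewrite -{1}(reprW a) mulW_word; apply/wordWP.
by rewrite -{1}[repr a]revK; exact: cox_revl.
Qed.

HB.instance Definition _ := isGroup.Build weyl mulWA mul1W mulW1 mulVW mulWV.

Definition sgen (i : vertex) : weyl := wordW [:: i].

Section Action.
Variable K : fieldType.
Notation V := {freeg vertex / K}.
Implicit Types (x : V) (i j k : vertex).

Definition omega i : V := << i >>.

Definition refl_basis i j : V :=
  if j == i then - omega i + \sum_(k <- nbrs i) omega k else omega j.

Definition refl i : V -> V := fglift (refl_basis i).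

HB.instance Definition _ i :=
  GRing.isZmodMorphism.Build V V (refl i) (lift_is_additive (refl_basis i)).

Definition act_word (w : seq vertex) x : V := foldr refl x w.

Definition act (sigma : weyl) x : V := act_word (repr sigma) x.

Lemma coeff_refl_basis i j k :
  coeff k (refl_basis i j) =
  (j == k)%:R + (j == i)%:R * ((adj i k)%:R - (i == k)%:R *+ 2).
Proof.
rewrite /refl_basis; case: eqP => [->|_]; last first.
  by rewrite /omega coeffU mul1r mul0r addr0.
rewrite coeffD coeffN.
have -> : coeff k (\sum_(l <- nbrs i) omega l) = (adj i k)%:R.
  rewrite raddf_sum /=; under eq_bigr do rewrite /omega coeffU mul1r.
  have uN : uniq (nbrs i) by case: i => [||[|n]|[|n]] //=;
    rewrite !inE ?vYE ?vZE ?andbT; apply/eqP => [] [] /eqP; rewrite -addn2 -{1}[n]addn0 eqn_add2l.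
  rewrite /adj; elim: (nbrs i) uN => [|l s IH] /=; first by rewrite big_nil.
  move=> /andP[ls us]; rewrite big_cons IH // inE eq_sym.
  by case: eqP => [->|_] /=; rewrite ?(negbTE ls) ?addr0 ?add0r.
by rewrite /omega coeffU !mul1r; ring.
Qed.

Lemma coeff_refl i k x :
  coeff k (refl i x) =
  coeff k x + coeff i x * ((adj i k)%:R - (i == k)%:R *+ 2).
Proof.
have fgE (f : vertex -> K) (l : vertex) :
    \sum_(z <- dom x) coeff z x * ((z == l)%:R * f l) = coeff l x * f l.
  case: (boolP (l \in dom x)) => [lx|lx].
    rewrite (bigD1_seq l) ?uniq_dom //= eqxx mul1r big1 ?addr0 // => z zl.
    by rewrite (negbTE zl) mul0r mulr0.
  rewrite (coeff_outdom lx) mul0r big_seq big1 // => z zx.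
  by case: eqP => [zl|]; rewrite ?mul0r ?mulr0 //; rewrite -zl zx in lx.
rewrite -{1}(freeg_sumE x) raddf_sum raddf_sum /=.
under eq_bigr do rewrite /refl liftU coeffZ coeff_refl_basis mulrDr.
rewrite big_split /=; congr (_ + _); last first.
  by rewrite (fgE (fun l => (adj l k)%:R - (l == k)%:R *+ 2) i).
by under eq_bigr do rewrite -[(_ == k)%:R]mulr1; rewrite (fgE (fun=> 1)) mulr1.
Qed.

Lemma refl_scalable i : scalable (refl i).
Proof.
move=> a x; apply/eqP/freeg_eqP => k.
by rewrite coeffZ !coeff_refl !coeffZ [RHS]mulrDr mulrA.
Qed.

HB.instance Definition _ i :=
  GRing.isScalable.Build K V V *:%R (refl i) (refl_scalable i).

Lemma act_word_cat v w x : act_word (v ++ w) x = act_word v (act_word w x).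
Proof. exact: foldr_cat. Qed.

Lemma act_word_cox w w' : cox w w' -> act_word w =1 act_word w'.
Proof.
elim=> {w w'} //=.
- by move=> w w' _ h x; rewrite h.
- by move=> w1 w2 w3 _ h12 _ h23 x; rewrite h12.
- by move=> v v' w w' _ hv _ hw x; rewrite !act_word_cat hw hv.
- move=> i x; apply/eqP/freeg_eqP => k /=.
  by rewrite !coeff_refl adj_irr eqxx /=; ring.
- move=> i j aij x; apply/eqP/freeg_eqP => k /=.
  have nij : (i == j) = false by apply/eqP => ij; rewrite ij adj_irr in aij.
  rewrite !coeff_refl !adj_irr !eqxx [j == i]eq_sym nij [adj j i]adj_sym aij /=.
  ring.
- move=> i j naij x; apply/eqP/freeg_eqP => k /=.
  have [->//|/negbTE nij] := eqVneq i j.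
  rewrite !coeff_refl [j == i]eq_sym nij [adj j i]adj_sym (negbTE naij) /=.
  ring.
Qed.

Lemma act_wordW w : act (wordW w) =1 act_word w.
Proof. by apply: act_word_cox; exact: cox_repr. Qed.

Lemma act_gen_neq i j : i != j -> act (sgen i) (omega j) = omega j.
Proof.
move=> nij; rewrite act_wordW /= /refl /omega liftU scale1r.
by rewrite /refl_basis eq_sym (negbTE nij).
Qed.

Lemma act_gen_eq i :
  act (sgen i) (omega i) = - omega i + \sum_(k <- nbrs i) omega k.
Proof.
by rewrite act_wordW /= /refl {1}/omega liftU scale1r /refl_basis eqxx.
Qed.

Lemma act1 x : act 1%g x = x.
Proof. exact: act_wordW. Qed.

Lemma actM (sigma tau : weyl) x :
  act (sigma * tau)%g x = act sigma (act tau x).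
Proof. by rewrite act_wordW act_word_cat. Qed.

End Action.

Definition subgroup (A : set weyl) : Prop :=
  [/\ A 1%g, (forall a b, A a -> A b -> A (a * b)%g)
    & (forall a, A a -> A a^-1%g)].

Definition parabolic (t : vertex) : set weyl :=
  smallest subgroup [set sgen i | i in [set i | i != t]].

Definition dcoset (t' t : vertex) (sigma : weyl) : set weyl :=
  [set (a * sigma * b)%g | a in parabolic t' & b in parabolic t].

Lemma len_subproof (sigma : weyl) :
  exists n, `[< exists2 w, size w = n & wordW w = sigma >].
Proof.
by exists (size (repr sigma)); apply/asboolP; exists (repr sigma); rewrite ?reprW.
Qed.

Definition len (sigma : weyl) : nat := ex_minn (len_subproof sigma).

Definition minrep (t' t : vertex) : set weyl :=
  [set sigma | forall tau, dcoset t' t sigma tau -> (len sigma <= len tau)%N].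

Definition swap (v : vertex) : vertex :=
  match v with
  | vY j => vZ j
  | vZ j => vY j
  | _ => v
  end.

Definition chi (sigma : weyl) : weyl := wordW (map swap (repr sigma)).

Lemma swapK : involutive swap.
Proof. by case. Qed.

Lemma adj_swap v w : adj (swap v) (swap w) = adj v w.
Proof. by case: v w => [||[|i]|[|i]] [||[|j]|[|j]]. Qed.

Lemma cox_swap w w' : cox w w' -> cox (map swap w) (map swap w').
Proof.
elim=> {w w'} /=.
- by move=> w; exact: cox_refl.
- by move=> w w' _; exact: cox_symm.
- by move=> w1 w2 w3 _ h12 _ h23; exact: cox_trans h12 h23.
- by move=> v v' w w' _ hv _ hw; rewrite !map_cat; exact: cox_cat.
- by move=> i; exact: cox_sq.
- by move=> i j aij; apply: cox_braid; rewrite adj_swap.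
- by move=> i j aij; apply: cox_comm; rewrite adj_swap.
Qed.

Lemma chi_wordW w : chi (wordW w) = wordW (map swap w).
Proof. by apply/wordWP; apply: cox_swap; exact: cox_repr. Qed.

Lemma chi_gen i : chi (sgen i) = sgen (swap i).
Proof. exact: chi_wordW. Qed.

Lemma chiM : {morph chi : sigma tau / (sigma * tau)%g}.
Proof.
move=> a b; rewrite -(reprW a) -(reprW b).
by rewrite [(_ * _)%g]mulW_word !chi_wordW map_cat -mulW_word.
Qed.

Lemma chiK : involutive chi.
Proof.
by move=> a; rewrite -(reprW a) !chi_wordW mapK //; exact: swapK.
Qed.

(* The edges of the bipartite graph, between the two classes
   [minrep (vZ 0) vX] and [minrep (vY 0) vX] of vertices.                     *)
Definition licci3_bi (sigma sigma' : weyl) : Prop :=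
  [/\ minrep (vZ 0) vX sigma, minrep (vY 0) vX sigma'
    & dcoset (vZ 0) vX sigma `&` dcoset (vY 0) vX sigma' !=set0].

(* [(sigma, tau)] is the pair [(sigma, chi^-1 sigma')] of an edge
   [(sigma, sigma')] of the bipartite graph.                                  *)
Definition licci3_edge (sigma tau : weyl) : Prop :=
  minrep (vZ 0) vX tau /\
  exists2 sigma', licci3_bi sigma sigma' & chi tau = sigma'.

Definition licci3 (sigma tau : weyl) : Prop :=
  licci3_edge sigma tau \/ licci3_edge tau sigma.

Definition lseq_lambda (j : nat) : vertex :=
  match j with
  | 0 => vX
  | 1 => vU
  | j.+2 => vY j
  end.

Definition lseq_mu (j : nat) : vertex := vZ j.+1.

(* Partitions are infinite sequences, [lam k] being the (k+1)-st part; the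
   sums below have finite support.                                            *)
Definition corresponds (K : fieldType) (sigma : weyl) (lam mu : nat -> int) :=
  forall k : nat,
    (lam k)%:~R = \sum_(j \in [set j | (k <= j)%N])
                    coeff (lseq_lambda j) (act sigma (omega K vX)) /\
    (mu k)%:~R = \sum_(j \in [set j | (k <= j)%N])
                    coeff (lseq_mu j) (act sigma (omega K vX)).

(* [g] is the infinite list [f] sorted in non-increasing order.               *)
Definition is_rsort (f g : nat -> int) : Prop :=
  (forall k, g k.+1 <= g k) /\
  exists2 pi : nat -> nat, bijective pi & forall k, g k = f (pi k).

Definition remove_at (i : nat) (f : nat -> int) : nat -> int :=
  fun k => f (bump i k).

(* For [i < j < k], removing the largest position first leaves the meaning of
   the smaller ones unchanged.                                                *)
Definition mu_link (lam : nat -> int) (i j k : nat) : nat -> int :=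
  remove_at i (remove_at j (remove_at k lam)).

Definition link_shift (lam mu : nat -> int) (i j k : nat) : int :=
  \sum_(n \in [set: nat]) mu_link lam i j k n - \sum_(n \in [set: nat]) mu n.

Definition lambda_link_unsorted (lam mu : nat -> int) (i j k : nat) : nat -> int :=
  fun n =>
    let p := link_shift lam mu i j k in
    match n with
    | 0 => lam i + p
    | 1 => lam j + p
    | 2 => lam k + p
    | n.+3 => mu n
    end.

(* Main.v *)
(** In the coordinates (lambda, mu), completed by the coefficient at z_1 (which
    the invariant functionals of the action determine from lambda and mu), the
    generators other than s_(z_1) act by adjacent transpositions of lambda or
    of mu.  Reading the same weight in the coordinates with the y- and z-arms
    exchanged turns (lambda, mu) into the pair made of
    (lambda_1 + p, lambda_2 + p, lambda_3 + p, mu_1, mu_2, ...) and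
    (lambda_4, lambda_5, ...).  An edge of Licci_3 therefore amounts to
    permuting lambda so that the chosen parts come first, changing coordinates,
    and sorting; sortedness of the coordinates of a minimal double coset
    representative is the positivity of the coefficients of
    [sigma omega_(x_1)] away from z_1, proved by induction on the length. *)
Require Import Defs.
From mathcomp Require Import all_boot all_order all_algebra.
From mathcomp Require Import classical_sets.
From mathcomp Require Import zify ring.
From mathcomp Require Import boolp fsbigop freeg.

Set Implicit Arguments.
Unset Strict Implicit.
Unset Printing Implicit Defensive.

Import Order.TTheory GRing.Theory Num.Theory.

Section Sequences.
Local Open Scope classical_set_scope.
Local Open Scope ring_scope.
Implicit Types (f g : nat -> int) (i j k m n : nat).

Definition finsupp f := exists N, forall n, (N <= n)%N -> f n = 0.

Definition total f : int := \sum_(n \in [set: nat]) f n.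

Lemma fsum_tail (R : nmodType) (f : nat -> R) N k :
  (forall n, (N <= n)%N -> f n = 0) ->
  \sum_(n \in [set n | (k <= n)%N]) f n = \sum_(k <= n < N) f n.
Proof.
move=> f0; rewrite (fsbigE (index_iota k N)) ?iota_uniq //.
- rewrite big_seq_cond [RHS]big_seq; apply: eq_bigl => n.
  rewrite mem_index_iota; case: (leqP k n) => //= kn.
  by rewrite mem_set ?andbT.
- by move=> n /=; rewrite mem_index_iota => /andP[].
- by move=> n /= kn; rewrite mem_index_iota kn /= -leqNgt; exact: f0.
Qed.

Lemma totalE f N : (forall n, (N <= n)%N -> f n = 0) ->
  total f = \sum_(0 <= n < N) f n.
Proof.
move=> f0; rewrite -(fsum_tail _ f0) /total; apply: eq_fsbigl.
by apply/seteqP; split.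
Qed.

Lemma total_cons f : finsupp f -> total f = f 0%N + total (fun n => f n.+1).
Proof.
move=> [N f0].
rewrite (@totalE f N.+1) => [|n /ltnW]; last exact: f0.
rewrite (@totalE (fun n => f n.+1) N) => [|n /leqW]; last exact: f0.
by rewrite big_nat_recl.
Qed.

Lemma total_bij f (pi : nat -> nat) :
  bijective pi -> total (fun n => f (pi n)) = total f.
Proof. by move=> bpi; rewrite /total [RHS](reindex_fsbigT pi). Qed.

Lemma finsuppS f : finsupp f -> finsupp (fun n => f n.+1).
Proof. by move=> [N f0]; exists N => n Nn; apply: f0; exact: leqW. Qed.

Definition transp j n := if n == j then j.+1 else if n == j.+1 then j else n.

Lemma transpK j : involutive (transp j).
Proof. by move=> n; rewrite /transp; do !case: eqP => //; lia. Qed.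

Lemma transp_bij j : bijective (transp j).
Proof. exact: inv_bij (transpK j). Qed.

Lemma finsupp_transp f j : finsupp f -> finsupp (fun n => f (transp j n)).
Proof.
move=> [N f0]; exists (maxn N j.+2) => n; rewrite geq_max => /andP[Nn jn].
by rewrite /transp; do 2?[case: eqP => [?|_]; first lia]; exact: f0.
Qed.

Lemma diff_transp f j n :
  f (transp j n) - f (transp j n.+1) = f n - f n.+1 +
    (f j - f j.+1) * (((j == n.+1) || (n == j.+1))%:R - (j == n)%:R *+ 2).
Proof.
rewrite /transp eqSS (eq_sym j n) (eq_sym j n.+1).
have [->|_] := eqVneq n j.
  by rewrite (gtn_eqF (ltnSn j)) (ltn_eqF (ltnSn j)) /=; ring.
have [->|_] := eqVneq n j.+1.
  by rewrite (gtn_eqF (leqnSn j.+1)) /=; ring.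
by have [->|_] := eqVneq n.+1 j => /=; ring.
Qed.

Lemma nonincP f : (forall n, f n.+1 <= f n) -> {homo f : m n / (m <= n)%N >-> n <= m}.
Proof.
move=> fS m n /subnK <-; elim: (n - m)%N => //= d IH.
by rewrite addSn; exact: le_trans (fS _) IH.
Qed.

Lemma noninc_bij_le f g (rho : nat -> nat) :
  (forall n, f n.+1 <= f n) -> (forall n, g n.+1 <= g n) -> injective rho ->
  (forall n, g n = f (rho n)) -> forall n, g n <= f n.
Proof.
move=> fS gS rho_inj gE n.
have [m mn nm] : exists2 m, (m <= n)%N & (n <= rho m)%N.
  apply: contrapT => noM.
  have /uniq_leq_size : uniq [seq rho m | m <- iota 0 n.+1].
    by rewrite map_inj_uniq // iota_uniq.
  move/(_ (iota 0 n)); rewrite size_map !size_iota ltnn => bad.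
  suff : false by []; apply: bad => _ /mapP[m + ->]; rewrite !mem_iota => mn.
  by rewrite leq0n /= add0n ltnNge; apply/negP => nm; apply: noM; exists m.
by apply: (le_trans (nonincP gS mn)); rewrite gE; exact: nonincP.
Qed.

Lemma noninc_bij_eq f g (rho : nat -> nat) :
  (forall n, f n.+1 <= f n) -> (forall n, g n.+1 <= g n) -> bijective rho ->
  (forall n, g n = f (rho n)) -> g = f.
Proof.
move=> fS gS brho gE; apply: funext => n; apply/le_anti/andP; split.
  exact: (noninc_bij_le fS gS (bij_inj brho)).
have [rho' rhoK rho'K] := brho.
by apply: (noninc_bij_le gS fS (can_inj rho'K)) => m; rewrite gE rho'K.
Qed.

Definition skip3 i j k n := bump k (bump j (bump i n)).

Lemma mu_linkE f i j k n : mu_link f i j k n = f (skip3 i j k n).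
Proof. by []. Qed.

Lemma skip3_inj i j k : injective (skip3 i j k).
Proof. by move=> m n /(can_inj (@bumpK k))/(can_inj (@bumpK j))/(can_inj (@bumpK i)). Qed.

Lemma skip3_image i j k n : (i < j < k)%N ->
  (exists m, skip3 i j k m = n) <-> [/\ n <> i, n <> j & n <> k].
Proof.
move=> ijk; split=> [[m <-]|[ni nj nk]].
  by rewrite /skip3 /bump; do !case: leqP => ? /=; split; lia.
exists (unbump i (unbump j (unbump k n))).
by rewrite /skip3 !unbumpK // inE /unbump; repeat case: ltnP => ? /=; lia.
Qed.

Lemma mu_link_noninc f i j k : (forall n, f n.+1 <= f n) ->
  forall n, mu_link f i j k n.+1 <= mu_link f i j k n.
Proof.
by move=> fS n; apply: (nonincP fS); rewrite !leq_bump2.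
Qed.

Lemma bij_of_same_image (f g : nat -> nat) : injective f -> injective g ->
  (forall n, (exists m, f m = n) <-> (exists m, g m = n)) ->
  exists2 rho, bijective rho & forall n, f n = g (rho n).
Proof.
move=> fI gI fg.
have /choice[r rE] : forall n, exists m, g m = f n by move=> n; apply/fg; exists n.
have /choice[s sE] : forall n, exists m, f m = g n by move=> n; apply/fg; exists n.
exists r => [|n]; last by rewrite rE.
by exists s => n; [apply: fI; rewrite sE rE | apply: gI; rewrite rE sE].
Qed.

Lemma bij_skip3 (pi : nat -> nat) : bijective pi ->
  (pi 0%N < pi 1%N < pi 2%N)%N ->
  exists2 rho, bijective rho &
    forall n, pi n.+3 = skip3 (pi 0%N) (pi 1%N) (pi 2%N) (rho n).
Proof.
move=> bpi lt3; have piI := bij_inj bpi; have [q qK Kq] := bpi.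
apply: (@bij_of_same_image (fun n => pi n.+3)) => [m n /piI []//||n].
  exact: skip3_inj.
apply: (iff_trans _ (iff_sym (skip3_image _ lt3))); split.
  by move=> [m <-]; split=> /piI.
rewrite -(Kq n); case: (q n) => [|[|[|m]]] [] // *; by exists m.
Qed.

Definition lift3 (rho : nat -> nat) n := if n is m.+3 then (rho m).+3 else n.

Lemma lift3_bij rho : bijective rho -> bijective (lift3 rho).
Proof.
move=> [q qK Kq]; exists (lift3 q) => -[|[|[|n]]] //=; by rewrite ?qK ?Kq.
Qed.

End Sequences.

Section Group.
Local Open Scope classical_set_scope.
Implicit Types (sigma tau a b : weyl) (i j t : vertex) (w : seq vertex).

Lemma wordW_cons i w : wordW (i :: w) = (sgen i * wordW w)%g.
Proof. exact/esym/mulW_word. Qed.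

Lemma wordW_cat w w' : wordW (w ++ w') = (wordW w * wordW w')%g.
Proof. exact/esym/mulW_word. Qed.

Lemma weyl_ind (P : weyl -> Prop) :
  P 1%g -> (forall i sigma, P sigma -> P (sgen i * sigma)%g) ->
  forall sigma, P sigma.
Proof.
move=> P1 PM sigma; rewrite -(reprW sigma).
by elim: (repr sigma) => // i w IH; rewrite wordW_cons; exact: PM.
Qed.

Lemma sgenK i : (sgen i * sgen i = 1)%g.
Proof. by rewrite -wordW_cons; apply/wordWP; exact: cox_sq. Qed.

Lemma sgenKM i sigma : (sgen i * (sgen i * sigma) = sigma)%g.
Proof. by rewrite mulgA sgenK mul1g. Qed.

Lemma sgen_comm i j : ~~ adj i j -> (sgen i * sgen j = sgen j * sgen i)%g.
Proof. by move=> ij; rewrite -!wordW_cons; apply/wordWP; exact: cox_comm. Qed.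

Lemma sgen_braid i j : adj i j ->
  (sgen i * (sgen j * sgen i) = sgen j * (sgen i * sgen j))%g.
Proof.
move=> ij; have : wordW [:: i; j; i; j; i; j] = 1%g.
  by apply/wordWP; exact: cox_braid.
rewrite !wordW_cons => e.
by rewrite -[LHS]mulg1 -e -!mulgA !sgenKM mulg1.
Qed.

Lemma parabolic_subgroup t : subgroup (parabolic t).
Proof.
split=> [A [[] //]|a b Pa Pb A AP|a Pa A AP];
  have [[A1 AM AV] _] := AP; [exact: AM (Pa A AP) (Pb A AP)|exact: AV (Pa A AP)].
Qed.

Lemma parabolic_gen t i : i != t -> parabolic t (sgen i).
Proof. by move=> it A [_]; apply; exists i. Qed.

Lemma parabolic_word t :
  parabolic t `<=` [set a | exists2 w, all (predC1 t) w & a = wordW w].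
Proof.
apply: smallest_sub; last first.
  move=> _ [i it <-]; exists [:: i] => //=; rewrite andbT; exact: it.
split=> [|_ _ [v vt ->] [w wt ->]|_ [w wt ->]].
- by exists [::].
- by exists (v ++ w); rewrite ?all_cat ?vt ?wordW_cat.
- exists (rev w); rewrite ?all_rev //; apply: (mulgI (wordW w)).
  rewrite mulgV -wordW_cat; apply/esym/wordWP.
  by rewrite -{1}[w]revK; exact: cox_revl.
Qed.

Lemma parabolic_ind t (P : weyl -> Prop) : P 1%g ->
  (forall i a, i != t -> P a -> P (sgen i * a)%g) ->
  forall a, parabolic t a -> P a.
Proof.
move=> P1 PM a /parabolic_word[w wt ->]; elim: w wt => //= i w IH /andP[it /IH].
by rewrite wordW_cons; exact: PM.
Qed.

Lemma chi1 : chi 1%g = 1%g.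
Proof. exact: chi_wordW. Qed.

Lemma chi_parabolic t a : parabolic t a -> parabolic (swap t) (chi a).
Proof.
have [P1 PM _] := parabolic_subgroup (swap t).
elim/parabolic_ind => [|i {}a it Pa]; first by rewrite chi1.
rewrite chiM chi_gen; apply: PM => //; apply: parabolic_gen.
by rewrite (inj_eq (can_inj swapK)).
Qed.

Lemma dcoset_refl t' t sigma : dcoset t' t sigma sigma.
Proof.
have [P1 _ _] := parabolic_subgroup t'; have [Q1 _ _] := parabolic_subgroup t.
by exists 1%g => //; exists 1%g => //; rewrite mul1g mulg1.
Qed.

Lemma dcoset_sym t' t sigma tau :
  dcoset t' t sigma tau -> dcoset t' t tau sigma.
Proof.
have [_ _ PV] := parabolic_subgroup t'; have [_ _ QV] := parabolic_subgroup t.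
move=> [a Pa [b Qb <-]]; exists a^-1%g; first exact: PV.
by exists b^-1%g; [exact: QV | rewrite !mulgA mulVg mul1g mulgK].
Qed.

Lemma dcoset_trans t' t sigma tau upsilon :
  dcoset t' t sigma tau -> dcoset t' t tau upsilon -> dcoset t' t sigma upsilon.
Proof.
have [_ PM _] := parabolic_subgroup t'; have [_ QM _] := parabolic_subgroup t.
move=> [a Pa [b Qb <-]] [a' Pa' [b' Qb' <-]].
exists (a' * a)%g; first exact: PM.
by exists (b * b')%g; [exact: QM | rewrite !mulgA].
Qed.

Lemma dcoset_mull t' t sigma a : parabolic t' a -> dcoset t' t sigma (a * sigma)%g.
Proof.
have [Q1 _ _] := parabolic_subgroup t.
by move=> Pa; exists a => //; exists 1%g => //; rewrite mulg1.
Qed.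

Lemma dcoset_chi t' t sigma tau :
  dcoset t' t sigma tau -> dcoset (swap t') (swap t) (chi sigma) (chi tau).
Proof.
move=> [a Pa [b Qb <-]]; exists (chi a); first exact: chi_parabolic.
by exists (chi b); [exact: chi_parabolic | rewrite !chiM].
Qed.

Lemma len_word w : (len (wordW w) <= size w)%N.
Proof.
rewrite /len; case: ex_minnP => n _; apply.
by apply/asboolP; exists w.
Qed.

Lemma len_repr sigma : exists2 w, size w = len sigma & wordW w = sigma.
Proof. by rewrite /len; case: ex_minnP => n /asboolP. Qed.

Lemma len_gen i sigma : (len (sgen i * sigma)%g <= (len sigma).+1)%N.
Proof.
have [w <- <-] := len_repr sigma; rewrite -wordW_cons; exact: len_word.
Qed.

Lemma len_decomp sigma : sigma = 1%g \/
  exists i tau, sigma = (sgen i * tau)%g /\ (len tau < len sigma)%N.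
Proof.
have [[|i w] wl we] := len_repr sigma; first by left; rewrite -we.
right; exists i, (wordW w); rewrite -wordW_cons we; split=> //.
by rewrite -wl; exact: len_word.
Qed.

Lemma len_chi sigma : len (chi sigma) = len sigma.
Proof.
have le tau : (len (chi tau) <= len tau)%N.
  have [w <- <-] := len_repr tau.
  by rewrite chi_wordW -(size_map swap); exact: len_word.
by apply/eqP; rewrite eqn_leq le -{1}(chiK sigma) le.
Qed.

Lemma minrep_chi t' t sigma :
  minrep t' t sigma -> minrep (swap t') (swap t) (chi sigma).
Proof.
move=> sm tau /dcoset_chi; rewrite chiK !swapK => /sm.
by rewrite !len_chi.
Qed.

Lemma minrep_exists t' t sigma :
  exists2 tau, minrep t' t tau & dcoset t' t sigma tau.
Proof.
pose P n := `[< exists2 tau, dcoset t' t sigma tau & len tau = n >].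
have exP : exists n, P n.
  by exists (len sigma); apply/asboolP; exists sigma; first exact: dcoset_refl.
case: (ex_minnP exP) => _ /asboolP[tau st <-] tau_min; exists tau => // upsilon tu.
by apply: tau_min; apply/asboolP; exists upsilon; first exact: dcoset_trans tu.
Qed.

Lemma minrep_len_gen t' t sigma i : minrep t' t sigma -> i != t' ->
  (len sigma <= len (sgen i * sigma)%g)%N.
Proof. by move=> sm it; apply: sm; apply: dcoset_mull; exact: parabolic_gen. Qed.

Lemma licci3_edge_sym sigma tau : minrep (vZ 0) vX sigma ->
  licci3_edge sigma tau -> licci3_edge tau sigma.
Proof.
move=> sm [tm [upsilon [_ _ [rho [sr tr]]] e]]; split=> //; exists (chi sigma) => //.
split=> //; first exact: minrep_chi sm.
exists (chi rho); split; last exact: dcoset_chi sr.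
by rewrite -(chiK tau) e; exact: dcoset_chi tr.
Qed.

Lemma licci3_edgeE sigma tau : minrep (vZ 0) vX sigma ->
  licci3 sigma tau -> licci3_edge sigma tau.
Proof.
by move=> sm [//|e]; apply: licci3_edge_sym => //; case: e => _ [? []].
Qed.

End Group.

Section Weights.
Local Open Scope classical_set_scope.
Local Open Scope ring_scope.
Variable K : numFieldType.
Implicit Types (sigma tau a b : weyl) (v : vertex) (c : vertex -> K).
Implicit Types (lam mu : nat -> int).

Definition coef sigma v : K := coeff v (act sigma (omega K vX)).

Definition reflc (i : vertex) c v : K := c v + c i * ((adj i v)%:R - (i == v)%:R *+ 2).

Lemma coef1 v : coef 1%g v = (vX == v)%:R.
Proof. by rewrite /coef act1 /omega coeffU mul1r. Qed.

Lemma coef_gen i sigma : coef (sgen i * sigma)%g = reflc i (coef sigma).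
Proof. by apply: funext => v; rewrite /coef actM act_wordW /= coeff_refl. Qed.

Lemma coef_mulr sigma b : parabolic vX b -> coef (sigma * b)%g = coef sigma.
Proof.
move=> Pb; apply: funext => v; rewrite /coef actM; congr (coeff v (act _ _)).
elim/parabolic_ind: Pb => [|i {}b iX IH]; first exact: act1.
by rewrite actM IH act_gen_neq.
Qed.

Lemma reflc_swap i c :
  reflc (swap i) (fun v => c (swap v)) = (fun v => reflc i c (swap v)).
Proof.
apply: funext => v; rewrite /reflc swapK -(adj_swap i).
by rewrite -(inj_eq (can_inj swapK) i) swapK.
Qed.

Lemma coef_chi sigma : coef (chi sigma) = fun v => coef sigma (swap v).
Proof.
elim/weyl_ind: sigma => [|i sigma IH].
  by rewrite chi1; apply: funext => v; rewrite !coef1; case: v.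
by rewrite chiM chi_gen !coef_gen IH reflc_swap.
Qed.

(* Induction on the length through the rank two parabolic subgroup generated
   by [i] and the first letter [j] of a reduced word of [sigma].              *)
Lemma coef_ge0 sigma i : (len sigma <= len (sgen i * sigma)%g)%N -> 0 <= coef sigma i.
Proof.
have [n] := ubnP (len sigma); elim: n sigma i => // n IH sigma i.
rewrite ltnS => sn si; have [->|[j [tau [e ts]]]] := len_decomp sigma.
  by rewrite coef1 ler0n.
have IHt k : (len tau <= len (sgen k * tau)%g)%N -> 0 <= coef tau k.
  by apply: IH; exact: leq_trans sn.
have st : (len sigma <= (len tau).+1)%N by rewrite e len_gen.
have ij : i != j.
  by apply/eqP => ij; move: si; rewrite e ij sgenKM -e leqNgt ts.
have [aij|naij] := boolP (adj i j); last first.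
  have -> : coef sigma i = coef tau i.
    rewrite e coef_gen /reflc adj_sym (negbTE naij) eq_sym (negbTE ij).
    by rewrite mul0rn subr0 mulr0 addr0.
  apply: IHt; rewrite leqNgt; apply/negP => it.
  have := len_gen j (sgen i * tau)%g.
  rewrite mulgA -sgen_comm // -mulgA -e => /(leq_trans si); lia.
have coef_sigma : coef sigma i = coef tau i + coef tau j.
  by rewrite e coef_gen /reflc adj_sym aij eq_sym (negbTE ij) mul0rn subr0 mulr1.
have [it|ti] := leqP (len tau) (len (sgen i * tau)%g).
  by rewrite coef_sigma addr_ge0 ?IHt // -e ltnW.
set upsilon := (sgen i * tau)%g in ti.
have tauE : tau = (sgen i * upsilon)%g by rewrite sgenKM.
have ut := len_gen i upsilon; rewrite -tauE in ut.
have -> : coef sigma i = coef upsilon j.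
  rewrite coef_sigma tauE !coef_gen /reflc adj_irr aij eqxx (negbTE ij) /=; ring.
apply: IH; first lia.
rewrite leqNgt; apply/negP => ju.
have := len_gen j (sgen i * (sgen j * upsilon))%g.
have -> : (sgen j * (sgen i * (sgen j * upsilon)) = sgen i * sigma)%g.
  by rewrite e tauE !mulgA -(mulgA (sgen j)) sgen_braid ?mulgA // adj_sym.
move=> /(leq_trans si); have := len_gen i (sgen j * upsilon)%g; lia.
Qed.

(* The value at [vZ 0] is forced by the two invariant linear functionals of the
   action, those with [2 f i = sum of f over the neighbours of i].            *)
Definition represents c lam mu : Prop :=
  [/\ finsupp lam /\ finsupp mu,
      forall n, c (lseq_lambda n) = (lam n - lam n.+1)%:~R,
      forall n, c (lseq_mu n) = (mu n - mu n.+1)%:~R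
    & c (vZ 0) = (total lam - lam 0%N - lam 1%N - total mu - mu 0%N)%:~R].

Lemma adj_lambda m n :
  adj (lseq_lambda m) (lseq_lambda n) = (m == n.+1) || (n == m.+1).
Proof.
by case: m n => [|[|[|m]]] [|[|[|n]]] //; rewrite /adj /= !inE ?vYE ?eqSS //= eq_sym.
Qed.

Lemma eq_lambda m n : (lseq_lambda m == lseq_lambda n) = (m == n).
Proof. by case: m n => [|[|m]] [|[|n]]. Qed.

Lemma adj_mu m n : adj (lseq_mu m) (lseq_mu n) = (m == n.+1) || (n == m.+1).
Proof. by rewrite /adj /= !inE !vZE !eqSS eq_sym. Qed.

Lemma adj_lambda_mu m n : adj (lseq_lambda m) (lseq_mu n) = false.
Proof. by case: m n => [|[|[|m]]] [|n]. Qed.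

Lemma adj_lambda_z m : adj (lseq_lambda m) (vZ 0) = (m == 1%N).
Proof. by case: m => [|[|[|m]]]. Qed.

Lemma intr_bools (b b' : bool) :
  b%:R - b'%:R *+ 2 = (b%:R - b'%:R *+ 2 : int)%:~R :> K.
Proof. by rewrite -!mulrnA intrB !mulrz_nat. Qed.

Lemma represents_lambda c lam mu m : represents c lam mu ->
  represents (reflc (lseq_lambda m) c) (fun n => lam (transp m n)) mu.
Proof.
move=> [[fl fm] cl cm cz]; split=> [|n|n|]; first by split=> //; exact: finsupp_transp.
- rewrite /reflc diff_transp !cl adj_lambda eq_lambda.
  by rewrite intr_bools -rmorphM -rmorphD.
- rewrite /reflc; have -> : (lseq_lambda m == lseq_mu n) = false by case: m => [|[|m]].
  by rewrite adj_lambda_mu /= mul0rn subr0 mulr0 addr0 cm.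
have -> : (total (fun n => lam (transp m n))) = total lam.
  exact: total_bij (transp_bij m).
rewrite /reflc adj_lambda_z cz cl.
have -> : (lseq_lambda m == vZ 0) = false by case: m => [|[|m]].
rewrite mul0rn subr0; case: m => [|[|m]] /=; rewrite /transp /= ?mulr0 ?mulr1 ?addr0 //.
  congr (_%:~R); ring.
by rewrite -rmorphD; congr (_%:~R); ring.
Qed.

Lemma represents_mu c lam mu m : represents c lam mu ->
  represents (reflc (lseq_mu m) c) lam (fun n => mu (transp m n)).
Proof.
move=> [[fl fm] cl cm cz]; split=> [|n|n|]; first by split=> //; exact: finsupp_transp.
- rewrite /reflc; have -> : (lseq_mu m == lseq_lambda n) = false by case: n => [|[|n]].
  by rewrite adj_sym adj_lambda_mu /= mul0rn subr0 mulr0 addr0 cl.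
- rewrite /reflc diff_transp !cm adj_mu /lseq_mu vZE eqSS.
  by rewrite intr_bools -rmorphM -rmorphD.
have -> : (total (fun n => mu (transp m n))) = total mu.
  exact: total_bij (transp_bij m).
rewrite /reflc cz cm /adj /= !inE mul0rn subr0.
case: m => [|m] /=; rewrite /transp /= ?mulr0 ?mulr1 ?addr0 //.
by rewrite -rmorphD; congr (_%:~R); ring.
Qed.

Lemma represents_swap c lam mu : represents c lam mu ->
  represents (fun v => c (swap v))
    (lambda_link_unsorted lam mu 0 1 2) (mu_link lam 0 1 2).
Proof.
move=> [[fl fm] cl cm cz].
have fl1 := finsuppS fl; have fl2 := finsuppS fl1; have fl3 := finsuppS fl2.
have tot_lam := total_cons fl.
rewrite (total_cons fl1) (total_cons fl2) in tot_lam.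
set p := link_shift lam mu 0 1 2.
have pE : p = total (mu_link lam 0 1 2) - total mu by [].
split.
- split; last exact: fl3.
  have [N mu0] := fm; exists N.+3 => -[|[|[|n]]] //; exact: mu0.
- move=> [|[|[|n]]]; rewrite /= -/p.
  + by rewrite (cl 0%N); congr (_%:~R); ring.
  + by rewrite (cl 1%N); congr (_%:~R); ring.
  + by rewrite cz tot_lam pE; congr (_%:~R); rewrite /mu_link /remove_at /=; ring.
  + exact: cm.
- by move=> n; rewrite (cl n.+3).
have fL : finsupp (lambda_link_unsorted lam mu 0 1 2).
  have [N mu0] := fm; exists N.+3 => -[|[|[|n]]] //; exact: mu0.
have fL1 := finsuppS fL; have fL2 := finsuppS fL1.
rewrite (total_cons fL) (total_cons fL1) (total_cons fL2) /= -/p pE (cl 2%N).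
congr (_%:~R); rewrite /mu_link /remove_at /total /=; ring.
Qed.

Lemma represents_coef sigma : exists lam mu, represents (coef sigma) lam mu.
Proof.
elim/weyl_ind: sigma => [|i sigma [lam [mu sr]]].
  exists (fun n => (n == 0%N)%:R), (fun=> 0).
  have f1 : finsupp (fun n => (n == 0%N)%:R) by exists 1%N; case.
  have f0 : finsupp (fun=> 0) by exists 0%N.
  split=> [//|n|n|]; rewrite coef1.
  - by case: n => [|[|n]].
  - by rewrite subrr.
  - rewrite (total_cons f1) !(@totalE _ 0%N) //.
    by rewrite big_geq.
rewrite coef_gen.
have Lr m : exists lam mu, represents (reflc (lseq_lambda m) (coef sigma)) lam mu.
  by have := represents_lambda m sr; eauto.
case: i => [||m|m]; [exact: (Lr 1%N)|exact: (Lr 0%N)|exact: (Lr m.+2)|].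
have := represents_swap (represents_lambda m.+2 (represents_swap sr)).
rewrite -(reflc_swap (vY m)) /=.
have -> : (fun v => coef sigma (swap (swap v))) = coef sigma.
  by apply: funext => v; rewrite swapK.
by eauto.
Qed.

Lemma represents_corresponds sigma lam mu :
  represents (coef sigma) lam mu -> corresponds K sigma lam mu.
Proof.
have tail (f : nat -> int) (c : nat -> K) k : finsupp f ->
    (forall n, c n = (f n - f n.+1)%:~R) ->
    (f k)%:~R = \sum_(n \in [set n | (k <= n)%N]) c n.
  move=> [N f0] cE; have [kN|Nk] := leqP k N; last first.
    rewrite fsbig1 ?f0 ?(ltnW Nk) // => n /= kn.
    by rewrite cE !f0 ?subrr // (leq_trans (ltnW Nk)) // leqW.
  rewrite (@fsum_tail _ _ N) => [|n Nn]; last by rewrite cE !f0 ?subrr // leqW.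
  rewrite (eq_bigr _ (fun n _ => cE n)) -raddf_sum /=; congr (_%:~R).
  under eq_bigr do rewrite -opprB.
  by rewrite sumrN telescope_sumr // (f0 N) // sub0r opprK.
by move=> [[fl fm] cl cm _] k; split; apply: tail.
Qed.

Lemma corresponds_represents sigma lam mu :
  corresponds K sigma lam mu -> represents (coef sigma) lam mu.
Proof.
have [lam' [mu' sr]] := represents_coef sigma.
move=> sc; have sc' := represents_corresponds sr.
suff [-> ->] : lam = lam' /\ mu = mu' by [].
split; apply: funext => k; apply: (@intr_inj K).
  by rewrite (sc k).1 (sc' k).1.
by rewrite (sc k).2 (sc' k).2.
Qed.

Lemma represents_minrep sigma lam mu : minrep (vZ 0) vX sigma ->
  represents (coef sigma) lam mu ->
  (forall n, lam n.+1 <= lam n) /\ (forall n, mu n.+1 <= mu n).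
Proof.
move=> sm [_ cl cm _].
have ge0 v : v != vZ 0 -> 0 <= coef sigma v.
  by move=> vz; apply: coef_ge0; exact: minrep_len_gen sm vz.
split=> n; rewrite -subr_ge0 -(ler0z K).
  by rewrite -cl ge0 //; case: n => [|[|n]].
by rewrite -cm ge0.
Qed.

Lemma represents_parabolic sigma lam mu a : parabolic (vZ 0) a ->
  represents (coef sigma) lam mu ->
  exists pi rho, [/\ bijective pi, bijective rho &
    represents (coef (a * sigma)%g) (fun n => lam (pi n)) (fun n => mu (rho n))].
Proof.
move=> Pa sr; elim/parabolic_ind: Pa => [|i {}a iz [pi [rho [bpi brho ar]]]].
  by exists id, id; rewrite mul1g; split=> //; exists id.
rewrite -mulgA coef_gen.
have Lr m : exists pi' rho', [/\ bijective pi', bijective rho' &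
    represents (reflc (lseq_lambda m) (coef (a * sigma)%g))
      (fun n => lam (pi' n)) (fun n => mu (rho' n))].
  exists (pi \o transp m), rho; split=> //; first exact: bij_comp (transp_bij m).
  exact: represents_lambda ar.
case: i iz => [_|_|m _|[//|m] _].
- exact: (Lr 1%N).
- exact: (Lr 0%N).
- exact: (Lr m.+2).
exists pi, (rho \o transp m); split=> //; first exact: bij_comp (transp_bij m).
exact: (represents_mu m ar).
Qed.

Lemma represents_dcoset sigma lam mu tau : dcoset (vZ 0) vX sigma tau ->
  represents (coef sigma) lam mu ->
  exists pi rho, [/\ bijective pi, bijective rho &
    represents (coef tau) (fun n => lam (pi n)) (fun n => mu (rho n))].
Proof.
move=> [a Pa [b Qb <-]] sr; rewrite coef_mulr //; exact: represents_parabolic sr.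
Qed.

Definition front (k : nat) lam n : int := if n is m.+1 then lam (bump k m) else lam k.

Lemma represents_front sigma lam mu k : represents (coef sigma) lam mu ->
  exists2 a, parabolic (vZ 0) a & represents (coef (a * sigma)%g) (front k lam) mu.
Proof.
have [P1 PM _] := parabolic_subgroup (vZ 0).
elim: k sigma lam => [|k IH] sigma lam sr.
  by exists 1%g => //; rewrite mul1g; have -> : front 0 lam = lam by apply: funext; case.
have := represents_lambda k sr; rewrite -coef_gen => /IH[a Pa ar].
exists (a * sgen (lseq_lambda k))%g.
  by apply: PM => //; apply: parabolic_gen; case: k {IH sr ar} => [|[|k]].
rewrite -mulgA; congr (represents _ _ _): ar; apply: funext => -[|n] /=.
  by rewrite /transp eqxx.
congr (lam _); rewrite /transp /bump.
case: (ltngtP k n) => kn /=; rewrite ?add0n ?add1n.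
- by repeat case: ifP => /eqP ?; lia.
- by repeat case: ifP => /eqP ?; lia.
- by rewrite -kn eqxx; case: ifP => /eqP ?; lia.
Qed.

Definition arrange3 (i j k : nat) lam n : int :=
  match n with
  | 0 => lam i
  | 1 => lam j
  | 2 => lam k
  | m.+3 => lam (skip3 i j k m)
  end.

Lemma represents_arrange3 sigma lam mu i j k : (i < j < k)%N ->
  represents (coef sigma) lam mu ->
  exists2 a, parabolic (vZ 0) a & represents (coef (a * sigma)%g) (arrange3 i j k lam) mu.
Proof.
move=> /andP[ij jk] sr; have [_ PM _] := parabolic_subgroup (vZ 0).
have [a Pa /(represents_front j.+1)[b Pb /(represents_front i.+2)[d Pd ar]]] :=
  represents_front k sr.
exists (d * (b * a))%g; first by apply: (PM) => //; exact: PM.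
have bump_lt m n : (n < m)%N -> bump m n = n by rewrite /bump ltnNge => /negbTE->.
rewrite -!mulgA; congr (represents _ _ _): ar; apply: funext => -[|[|[|n]]] /=.
- by rewrite bumpS /= !bump_lt // (ltn_trans ij).
- by rewrite bump_lt.
- by [].
- by rewrite !bumpS /= !bumpS.
Qed.

Lemma represents_sort3 sigma lam mu (pi : nat -> nat) : bijective pi ->
  represents (coef sigma) (fun n => lam (pi n)) mu ->
  exists a pi', [/\ parabolic (vZ 0) a, parabolic (vY 0) a, bijective pi',
    represents (coef (a * sigma)%g) (fun n => lam (pi' n)) mu
    & (pi' 0%N < pi' 1%N < pi' 2%N)%N].
Proof.
have [P1 PM _] := parabolic_subgroup (vZ 0).
have [Q1 QM _] := parabolic_subgroup (vY 0).
move=> bpi; pose S (tau : weyl) (pi : nat -> nat) := exists a,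
  [/\ tau = (a * sigma)%g, parabolic (vZ 0) a, parabolic (vY 0) a, bijective pi
    & represents (coef tau) (fun n => lam (pi n)) mu].
have step m tau pi' : (m < 2)%N -> S tau pi' -> exists tau', S tau' (pi' \o transp m).
  move=> m2 [a [-> Pa Qa bpi' ar]]; exists (sgen (lseq_lambda m) * (a * sigma))%g.
  exists (sgen (lseq_lambda m) * a)%g; split; rewrite ?mulgA //.
  - by apply: PM => //; apply: parabolic_gen; case: m m2 => [|[|[]]].
  - by apply: QM => //; apply: parabolic_gen; case: m m2 => [|[|[]]].
  - exact: bij_comp (transp_bij m).
  - by rewrite -mulgA coef_gen; exact: (represents_lambda m ar).
move=> sr; have S0 : exists tau, S tau pi.
  by exists sigma, 1%g; rewrite mul1g.
suff [pi' [tau [a [-> Pa Qa bpi' ar]]] lt] :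
    exists2 pi', exists tau, S tau pi' & (pi' 0%N < pi' 1%N < pi' 2%N)%N.
  by exists a, pi'.
have neq (pi' : nat -> nat) m n : (exists tau, S tau pi') -> m <> n -> pi' m <> pi' n.
  by move=> [tau [a [_ _ _ /bij_inj pI _]]] mn /pI.
have [p1 S1 lt1] : exists2 pi', exists tau, S tau pi' & (pi' 0%N < pi' 1%N)%N.
  have := neq _ 0%N 1%N S0; case: (ltngtP (pi 0%N) (pi 1%N)) => [lt|lt|//->] ne.
  - by exists pi.
  - by exists (pi \o transp 0); [case: S0 => tau /step; apply|].
  - by case: ne.
have ne02 := neq _ 0%N 2%N S1; have ne12 := neq _ 1%N 2%N S1.
case: (ltnP (p1 1%N) (p1 2%N)) => le12; first by exists p1; rewrite ?lt1.
have [tau S1t] := S1; have [tau2 S2] := step 1%N _ _ isT S1t.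
case: (ltnP (p1 0%N) (p1 2%N)) => le02.
  exists (p1 \o transp 1); first by exists tau2.
  by rewrite /= /transp /=; lia.
have [tau3 S3] := step 0%N _ _ isT S2.
exists (p1 \o transp 1 \o transp 0); first by exists tau3.
by rewrite /= /transp /=; lia.
Qed.

End Weights.

Theorem theorem3p1 (K : numFieldType) (sigma : weyl) (lam mu : nat -> int)
    (sigma_min : minrep (vZ 0) vX sigma)
    (sigma_lam_mu : corresponds K sigma lam mu) :
  (forall i j k : nat, (i < j < k)%N ->
     exists lam_link : nat -> int,
       is_rsort (lambda_link_unsorted lam mu i j k) lam_link /\
       exists sigma_link : weyl,
         [/\ minrep (vZ 0) vX sigma_link,
             corresponds K sigma_link lam_link (mu_link lam i j k)
           & licci3 sigma sigma_link]) /\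
  (forall tau : weyl, minrep (vZ 0) vX tau -> licci3 sigma tau ->
     exists i j k : nat, (i < j < k)%N /\
     exists lam_link : nat -> int,
       is_rsort (lambda_link_unsorted lam mu i j k) lam_link /\
       corresponds K tau lam_link (mu_link lam i j k)).
Proof.
have sr := corresponds_represents sigma_lam_mu.
have [lamS muS] := represents_minrep sigma_min sr.
split=> [i j k ijk|tau tau_min /(licci3_edgeE sigma_min)].
  have [a Pa ar] := represents_arrange3 ijk sr.
  have := represents_swap ar; rewrite -coef_chi => cr.
  have [tau tau_min ctau] := minrep_exists (vZ 0) vX (chi (a * sigma)%g).
  have [pi [rho [bpi brho tr]]] := represents_dcoset ctau cr.
  have [linkS rhoS] := represents_minrep tau_min tr.
  have rho_id := noninc_bij_eq (mu_link_noninc i j k lamS) rhoS brho (fun=> erefl).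
  exists (fun n => lambda_link_unsorted lam mu i j k (pi n)); split.
    by split=> //; exists pi.
  exists tau; split=> //.
    by apply: represents_corresponds; rewrite -rho_id.
  left; split=> //; exists (chi tau) => //; split=> //; first exact: minrep_chi tau_min.
  exists (a * sigma)%g; split; first exact: dcoset_mull.
  by rewrite -[X in dcoset _ _ _ X]chiK; exact: dcoset_chi (dcoset_sym ctau).
move=> [_ [sigma' [_ _ [upsilon [su tu]]] chi_tau]]; rewrite -{sigma'}chi_tau in tu.
have [pi0 [rho [bpi0 brho ur]]] := represents_dcoset su sr.
have [a [pi [_ Qa bpi ar ijk]]] := represents_sort3 bpi0 ur.
have := represents_swap ar; rewrite -coef_chi => cr.
have ctau : dcoset (vZ 0) vX (chi (a * upsilon)%g) tau.
  rewrite -[X in dcoset _ _ _ X]chiK; apply: (@dcoset_chi (vY 0) vX).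
  exact: dcoset_sym (dcoset_trans tu (dcoset_mull _ _ Qa)).
have [pi' [rho' [bpi' brho' tr]]] := represents_dcoset ctau cr.
have [linkS rhoS] := represents_minrep tau_min tr.
have [r br rE] := bij_skip3 bpi ijk.
exists (pi 0%N), (pi 1%N), (pi 2%N); split=> //.
set i := pi 0%N in ijk rE *; set j := pi 1%N in ijk rE *; set k := pi 2%N in ijk rE *.
have mE : mu_link (fun n => lam (pi n)) 0 1 2 = fun n => mu_link lam i j k (r n).
  by apply: funext => n; rewrite !mu_linkE -rE.
have rho_id := noninc_bij_eq (mu_link_noninc i j k lamS) rhoS (bij_comp br brho').
exists (fun n =>
  lambda_link_unsorted (fun n => lam (pi n)) (fun n => mu (rho n)) 0 1 2 (pi' n)).
split; last first.
  by apply: represents_corresponds; rewrite -rho_id // => n; rewrite mE.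
split=> //; exists (lift3 rho \o pi'); first exact: bij_comp (lift3_bij brho) bpi'.
move=> n /=; have pE : link_shift (fun n => lam (pi n)) (fun n => mu (rho n)) 0 1 2 =
    link_shift lam mu i j k.
  by rewrite /link_shift mE; congr (_ - _)%R; exact: total_bij.
by case: (pi' n) => [|[|[|m]]] //=; rewrite pE.
Qed.
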